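(* Let $n\geq 2$ be an integer. Endow $\mathbb{Z}^n$ with the word metric associated to its canonical basis, and endow the free group $F_n$ of rank $n$ with the word metric associated to any free generating system. Then: (1) $\mathrm{gr}(\mathbb{Z}^n)=1$; (2) $\mathrm{gr}(F_n)=1$.
   Context: For a metric space $(X,d)$, the generalized roundness $\mathrm{gr}(X,d)$ (also written $\mathrm{gr}(X)$ when the metric is understood) is the supremum of all positive numbers $p$ such that for every integer $m\geq 2$ and any collection of $2m$ points $a_1,\ldots,a_m,b_1,\ldots,b_m$ in $X$ (repetitions allowed), the following inequality holds: $$\sum_{1\leq i<j\leq m}\bigl(d(a_i,a_j)^p + d(b_i,b_j)^p\bigr) \leq \sum_{1\leq i,j\leq m} d(a_i,b_j)^p.$$ The word metric on a group $G$ associated to a generating set $S$ is $d(g,h)=$ the smallest length of a word in $S\cup S^{-1}$ representing $g^{-1}h$. A free generating system of $F_n$ is a set of $n$ elements that freely generates $F_n$ (a free basis). *)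

(* Defs.v *)
From HB Require Import structures.
From mathcomp Require Import all_boot all_order all_algebra.
From mathcomp Require Import all_classical all_reals all_analysis.

Set Implicit Arguments.
Unset Strict Implicit.
Unset Printing Implicit Defensive.

Import Order.TTheory GRing.Theory Num.Theory.

Local Open Scope classical_set_scope.
Local Open Scope ring_scope.

Definition roundness_ineq (R : realType) (X : Type) (d : X -> X -> R) (p : R) :=
  forall (m : nat) (a b : 'I_m -> X), (2 <= m)%N ->
    \sum_(i < m) \sum_(j < m | (i < j)%N)
        (d (a i) (a j) `^ p + d (b i) (b j) `^ p)
    <= \sum_(i < m) \sum_(j < m) d (a i) (b j) `^ p.

(* The supremum is taken in the extended reals, as the set may be unbounded. *)
Definition gr (R : realType) (X : Type) (d : X -> X -> R) : \bar R :=
  ereal_sup [set p%:E | p in [set p : R | 0 < p /\ roundness_ineq d p]].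

(* A word in S and its inverses is a sequence of formal letters: (s, false)
   stands for s and (s, true) for s^-1. *)
Definition letter_val (G : groupType) (l : G * bool) : G :=
  if l.2 then (l.1^-1)%g else l.1.

Definition word_val (G : groupType) (w : seq (G * bool)) : G :=
  (\prod_(l <- w) letter_val l)%g.

Definition word_in (G : groupType) (S : set G) (w : seq (G * bool)) : Prop :=
  forall l, l \in w -> S l.1.

Definition reduced (G : groupType) (w : seq (G * bool)) : bool :=
  sorted (fun l l' => ~~ ((l.1 == l'.1) && (l.2 != l'.2))) w.

Definition freely_generates (G : groupType) (S : set G) : Prop :=
  forall g : G,
    exists! w : seq (G * bool), [/\ word_in S w, reduced w & word_val w = g].

Definition has_word_of_size (G : groupType) (S : set G) (g : G) (k : nat) :=
  exists w : seq (G * bool), [/\ word_in S w, size w = k & word_val w = g].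

(* The default value 0 is only reached when S does not generate g. *)
Definition word_length (G : groupType) (S : set G) (g : G) : nat :=
  xget 0%N [set k | has_word_of_size S g k /\
                    forall k', has_word_of_size S g k' -> (k <= k')%N].

Definition word_metric (R : realType) (G : groupType) (S : set G)
    (g h : G) : R :=
  (word_length S (g^-1 * h)%g)%:R.

(* [Algebra.to_multiplicative] is the library's view of an additive group as a
   [groupType], with * := +, 1 := 0 and ^-1 := -. *)
Definition Zn (n : nat) : groupType := Algebra.to_multiplicative 'rV[int]_n.

Definition canonical_basis (n : nat) : set (Zn n) :=
  range (fun i : 'I_n => (delta_mx 0 i : 'rV[int]_n)).
Arguments canonical_basis n : clear implicits.

(* Main.v *)
(* At p = 1 both word metrics are finite sums of cut semimetrics
   (1_H(x) - 1_H(y))^2, where H runs over the half-spaces x_j > k in Z^n, and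
   over the sets of elements whose reduced word has a given nonempty prefix in
   F_n. For a single function f, the difference of the two sides of the
   inequality for the kernel (f(x) - f(y))^2 is the square of
   sum_i f(a_i) - sum_i f(b_i).
   For p > 1 the inequality fails in Z^n on the unit square, and in F_n on the
   points a_i = s^i t^N against b_i = 1, with N = m^2 and m large. *)
Require Import Defs.
From mathcomp Require Import all_boot all_order all_algebra.
From mathcomp Require Import all_classical all_reals all_analysis.
From mathcomp Require Import zify ring lra.

Import Order.TTheory GRing.Theory Num.Theory.

Set Implicit Arguments.
Unset Strict Implicit.
Unset Printing Implicit Defensive.

Local Open Scope classical_set_scope.
Local Open Scope ring_scope.

(** * Sums of squares and the inequality at exponent 1 *)

Lemma sum_ord_sym (V : nmodType) (m : nat) (f : 'I_m -> 'I_m -> V) :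
  (forall i, f i i = 0) -> (forall i j, f i j = f j i) ->
  \sum_i \sum_j f i j = (\sum_(i < m) \sum_(j < m | (i < j)%N) f i j) *+ 2.
Proof.
move=> f0 fC; rewrite mulr2n.
transitivity (\sum_(i < m) (\sum_(j < m | (i < j)%N) f i j +
                            \sum_(j < m | (j < i)%N) f i j)).
  apply: eq_bigr => i _; rewrite (bigID (fun j : 'I_m => (i < j)%N)) /=.
  congr (_ + _); rewrite (bigD1 i) ?ltnn //= f0 add0r.
  by apply: eq_bigl => j; rewrite -leqNgt ltn_neqAle andbC.
rewrite big_split /=; congr (_ + _).
rewrite (exchange_big_dep xpredT) //=.
by apply: eq_bigr => i _; apply: eq_bigr => j _.
Qed.

Lemma sqr_dist_ineq (R : realDomainType) (m : nat) (a b : 'I_m -> R) :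
  \sum_(i < m) \sum_(j < m | (i < j)%N) ((a i - a j) ^+ 2 + (b i - b j) ^+ 2)
  <= \sum_i \sum_j (a i - b j) ^+ 2.
Proof.
rewrite -(@ler_pMn2r _ 2) // -sum_ord_sym; first last.
- by move=> i j; ring.
- by move=> i; rewrite !subrr expr0n addr0.
(* Symmetrised like this, the two sides differ term by term by 2 (a_i - b_i) (a_j - b_j), which sums
   to twice a square. *)
have -> : (\sum_i \sum_j (a i - b j) ^+ 2) *+ 2 =
    \sum_i \sum_j ((a i - b j) ^+ 2 + (a j - b i) ^+ 2).
  rewrite mulr2n {2}exchange_big -big_split /=.
  by apply: eq_bigr => i _; rewrite -big_split.
have sq_ge0 : 0 <= ((\sum_i (a i - b i)) * (\sum_i (a i - b i))) *+ 2.
  by rewrite mulrn_wge0 // -expr2 sqr_ge0.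
rewrite -subr_ge0; apply: le_trans sq_ge0 _.
rewrite big_distrlr /= -sumrMnl -sumrB ler_sum // => i _.
rewrite -sumrMnl -sumrB ler_sum // => j _.
by rewrite le_eqVlt; apply/orP; left; apply/eqP; ring.
Qed.

(** The functions may depend on the finite family of points, which keeps the sum finite even when
    the space has infinitely many cuts. Each function contributes an instance of [sqr_dist_ineq]. *)
Lemma roundness_ineq_sum_sqr (R : realType) (X : Type) (d : X -> X -> R) :
  (forall (I : finType) (x : I -> X),
     exists (T : Type) (r : seq T) (f : T -> I -> R),
       forall i j, d (x i) (x j) = \sum_(t <- r) (f t i - f t j) ^+ 2) ->
  roundness_ineq d 1.
Proof.
move=> dE m a b _.
have [T [r [f {}dE]]] := dE ('I_m + 'I_m)%type
  (fun k => match k with inl i => a i | inr i => b i end).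
have daa i j := dE (inl i) (inl j); have dbb i j := dE (inr i) (inr j).
have dab i j := dE (inl i) (inr j); rewrite /= in daa dbb dab.
have sqr_ge0r (x : T -> R) : 0 <= \sum_(t <- r) x t ^+ 2.
  by apply: sumr_ge0 => t _; apply: sqr_ge0.
under eq_bigr => i _ do under eq_bigr => j _ do
  rewrite daa dbb !powRr1 ?sqr_ge0r // -big_split /=.
under [leRHS]eq_bigr => i _ do under eq_bigr => j _ do
  rewrite dab powRr1 ?sqr_ge0r //.
under eq_bigr => i _ do rewrite exchange_big.
under [leRHS]eq_bigr => i _ do rewrite exchange_big.
rewrite exchange_big [leRHS]exchange_big ler_sum // => t _.
exact: sqr_dist_ineq.
Qed.

Lemma gr_eq1 (R : realType) (X : Type) (d : X -> X -> R) :
  roundness_ineq d 1 -> (forall p, 1 < p -> ~ roundness_ineq d p) ->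
  gr d = 1%E.
Proof.
move=> d1 dN; apply/eqP; rewrite eq_le; apply/andP; split.
  apply: ge_ereal_sup => _ [p [p0 dp] <-]; rewrite lee_fin leNgt.
  by apply/negP => /dN.
by apply: ereal_sup_ubound; exists 1.
Qed.

Lemma roundness_ineq_quadrilateral (R : realType) (X : Type) (d : X -> X -> R)
    (p : R) (a0 a1 b0 b1 : X) :
  roundness_ineq d p ->
  d a0 a1 `^ p + d b0 b1 `^ p <=
    d a0 b0 `^ p + d a0 b1 `^ p + (d a1 b0 `^ p + d a1 b1 `^ p).
Proof.
move=> /(_ 2%N (fun i => if i == ord0 then a0 else a1)
            (fun i => if i == ord0 then b0 else b1) isT).
under eq_bigr => i _ do rewrite big_mkcond.
by rewrite 3!big_ord_recl !big_ord0 /= !big_ord_recl !big_ord0 /= !addr0 !add0r.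
Qed.

(** * Word length in a group *)

Lemma word_length_eq (G : groupType) (S : set G) (g : G) (k : nat) :
  has_word_of_size S g k ->
  (forall k', has_word_of_size S g k' -> (k <= k')%N) ->
  word_length S g = k.
Proof.
move=> gk kmin; apply: xget_unique => // l [gl lmin].
by apply/eqP; rewrite eqn_leq lmin // kmin.
Qed.

Lemma has_word_of_size1 (G : groupType) (S : set G) : has_word_of_size S 1%g 0.
Proof. by exists [::]; split=> //; rewrite /word_val big_nil. Qed.

Lemma has_word_of_sizeM (G : groupType) (S : set G) (g h : G) (k l : nat) :
  has_word_of_size S g k -> has_word_of_size S h l ->
  has_word_of_size S (g * h)%g (k + l).
Proof.
move=> [v [vS <- <-]] [w [wS <- <-]]; exists (v ++ w); split.
- by move=> x; rewrite mem_cat => /orP[/vS|/wS].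
- by rewrite size_cat.
- by rewrite /word_val big_cat.
Qed.

Lemma has_word_of_sizeX (G : groupType) (S : set G) (g : G) (k : nat) :
  has_word_of_size S g 1 -> has_word_of_size S (g ^+ k)%g k.
Proof.
move=> gS; elim: k => [|k IH]; first exact: has_word_of_size1.
by rewrite expgS -add1n; apply: has_word_of_sizeM.
Qed.

(** * The lattice Z^n and its l1 norm *)

Definition l1norm (n : nat) (x : 'rV[int]_n) : nat := (\sum_i `|x 0%R i|)%N.

Lemma l1normD (n : nat) (x y : 'rV[int]_n) :
  (l1norm (x + y)%R <= l1norm x + l1norm y)%N.
Proof.
rewrite /l1norm -big_split; apply: leq_sum => i _; rewrite mxE /=; lia.
Qed.

Lemma l1normN (n : nat) (x : 'rV[int]_n) : l1norm (- x)%R = l1norm x.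
Proof. by apply: eq_bigr => i _; rewrite mxE abszN. Qed.

Lemma l1norm_comb2 (n : nat) (i j : 'I_n) (s t : int) : i != j ->
  l1norm (s *: delta_mx 0 i + t *: delta_mx 0 j) = (`|s| + `|t|)%N.
Proof.
move=> ij; rewrite /l1norm (bigD1 i) // (bigD1 j) 1?eq_sym //= big1 => [|k].
  rewrite !mxE /= !eqxx (negPf ij) eq_sym (negPf ij) !mulr1 !mulr0.
  by rewrite addr0 add0r addn0.
by move=> /andP[/negPf ki /negPf kj]; rewrite !mxE /= ki kj !mulr0 addr0.
Qed.

Lemma l1norm_delta (n : nat) (i : 'I_n) : l1norm (delta_mx 0 i) = 1%N.
Proof.
rewrite /l1norm (bigD1 i) //= big1 ?mxE ?eqxx // => k /negPf ki.
by rewrite mxE ki.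
Qed.

(** Concatenating powers of basis letters, coordinate by coordinate, attains the norm; no word is
    shorter, since the norm is subadditive and equals 1 on each letter. *)
Lemma word_length_Zn (n : nat) (x : Zn n) :
  word_length (canonical_basis n) x = l1norm x.
Proof.
apply: word_length_eq => [|k [w [wS <- <-]]].
  have ->: x = \sum_(j < n) (x : 'rV[int]_n) 0 j *: delta_mx 0 j
    by exact: row_sum_delta.
  rewrite -[in l1norm _]row_sum_delta.
  pose K (v : 'rV[int]_n) k := has_word_of_size (canonical_basis n) v k.
  apply: (big_ind2 K) => [|u k v l|j _].
  - exact: (@has_word_of_size1 (Zn n)).
  - exact: (@has_word_of_sizeM (Zn n)).
  have deltaS : canonical_basis n (delta_mx 0 j) by exists j.
  case: (x 0 j) => k.
    rewrite -natz scaler_nat natz.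
    apply: (@has_word_of_sizeX (Zn n)); exists [:: (delta_mx 0 j, false)].
    split=> // [l|]; first by rewrite inE => /eqP ->.
    by rewrite /word_val big_seq1.
  rewrite NegzE scaleNr -natz scaler_nat -mulNrn natz abszN.
  apply: (@has_word_of_sizeX (Zn n)); exists [:: (delta_mx 0 j, true)].
  split=> // [l|]; first by rewrite inE => /eqP ->.
  by rewrite /word_val big_seq1.
elim: w wS => [|l w IH] wS.
  rewrite /word_val big_nil /l1norm big1 // => i _.
  by rewrite [X in absz X]mxE.
rewrite /word_val big_cons.
apply: leq_trans (l1normD _ _) _; apply: (@leq_add _ _ 1).
  have [j _ lj] := wS l (mem_head _ _); rewrite /letter_val.
  by case: l.2; rewrite -lj ?l1normN l1norm_delta.
by apply: IH => l' l'w; apply: wS; rewrite inE l'w orbT.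
Qed.

Lemma sum_ltn_ord (R : pzSemiRingType) (m k : nat) : (k <= m)%N ->
  \sum_(i < m) (i < k)%N%:R = k%:R :> R.
Proof.
move=> /minn_idPl {2}<-; rewrite -natr_sum; congr _%:R.
elim: m => [|m IH]; first by rewrite big_ord0 minn0.
by rewrite big_ord_recr /= IH; lia.
Qed.

(** Exactly |k - l| thresholds i separate k from l, all of them below [m], and each contributes
    1. *)
Lemma distn_sum_sqr (R : pzRingType) (m k l : nat) :
  (k <= m)%N -> (l <= m)%N ->
  `|k%:Z - l%:Z|%N%:R =
    \sum_(i < m) ((i < k)%N%:R - (i < l)%N%:R) ^+ 2 :> R.
Proof.
wlog kl : k l / (k <= l)%N => [th km lm|km lm].
  have [kl|/ltnW lk] := leqP k l; first exact: th.
  rewrite distnC th //; apply: eq_bigr => i _.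
  by rewrite -sqrrN opprB.
rewrite distnEr // natrB // -(sum_ltn_ord R km) -(sum_ltn_ord R lm) -sumrB.
apply: eq_bigr => i _.
have [ik|ki] := ltnP i k; first by rewrite (leq_trans ik kl) !subrr expr0n.
by rewrite subr0 sub0r sqrrN; case: ltnP; rewrite ?expr1n ?expr0n.
Qed.

Lemma Zn_sum_sqr (R : realType) (n : nat) (I : finType) (x : I -> Zn n) :
  exists (T : Type) (r : seq T) (f : T -> I -> R),
    forall i j, word_metric R (canonical_basis n) (x i) (x j) =
      \sum_(t <- r) (f t i - f t j) ^+ 2.
Proof.
pose c i j : int := (x i : 'rV[int]_n) 0 j.
(* [M] bounds every coordinate of the family; shifting by [M] puts coordinates between 0 and 2M, so
   2M half-spaces per direction suffice. *)
pose M := (\max_(q : I * 'I_n) `|c q.1 q.2|)%N.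
have cM i j : (`|c i j| <= M)%N by exact: (leq_bigmax (i, j)).
exists ('I_n * 'I_(M + M))%type, (index_enum _),
  (fun (t : 'I_n * 'I_(M + M)) i => (t.2 < absz (c i t.1 + M%:Z)%R)%N%:R).
move=> i j.
rewrite /word_metric word_length_Zn /l1norm natr_sum.
rewrite -(pair_bigA _ (fun (u : 'I_n) (v : 'I_(M + M)) =>
  ((v < absz (c i u + M%:Z)%R)%N%:R -
    (v < absz (c j u + M%:Z)%R)%N%:R) ^+ 2)) /=.
apply: eq_bigr => u _.
have := cM i u; have := cM j u => Hj Hi.
rewrite -distn_sum_sqr; [|lia|lia]; congr _%:R.
have -> : ((x i)^-1 * x j)%g 0 u = c j u - c i u by rewrite [LHS]mxE mxE addrC.
lia.
Qed.

Lemma Zn_not_roundness_ineq (R : realType) (n : nat) (p : R) :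
  (2 <= n)%N -> 1 < p ->
  ~ roundness_ineq (word_metric R (canonical_basis n)) p.
Proof.
move=> n2 p1.
pose e0 : 'rV[int]_n := delta_mx 0 (Ordinal (ltnW n2)).
pose e1 : 'rV[int]_n := delta_mx 0 (Ordinal n2).
have dE (x y : Zn n) (s t : int) : - (x : 'rV[int]_n) + y = s *: e0 + t *: e1 ->
    word_metric R (canonical_basis n) x y = (`|s| + `|t|)%N%:R.
  rewrite /word_metric word_length_Zn => E.
  by rewrite [X in l1norm X]E l1norm_comb2.
move=> /(@roundness_ineq_quadrilateral _ _ _ _ (0 : Zn n) (e0 + e1) e0 e1).
rewrite (dE _ _ 1 1); last by rewrite !scale1r oppr0 add0r.
rewrite (dE _ _ (-1) 1); last by rewrite !scaleN1r scale1r.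
rewrite (dE _ _ 1 0); last by rewrite scale1r scale0r oppr0 add0r addr0.
rewrite (dE _ _ 0 1); last by rewrite scale1r scale0r oppr0 !add0r.
rewrite (dE _ _ 0 (-1)); last by rewrite scaleN1r scale0r opprD addrAC addNr.
rewrite (dE _ _ (-1) 0); last by rewrite scaleN1r scale0r opprD -addrA addNr.
rewrite /= !powR1.
(* Two diagonals of length 2 against four sides of length 1: 2 * 2^p <= 4. *)
move=> h; have {h} : 2 `^ p <= 2 :> R by lra.
rewrite -ler_ln ?posrE ?powR_gt0 // ln_powR ger_pMl ?ln_gt0 ?ltr1n //.
by rewrite leNgt p1.
Qed.

(** * Reduced words and distances in a free group *)

Definition letter_inv (G : Type) (l : G * bool) : G * bool := (l.1, ~~ l.2).

Definition word_inv (G : Type) (w : seq (G * bool)) : seq (G * bool) :=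
  rev (map (@letter_inv G) w).

Lemma letter_val_inv (G : groupType) (l : G * bool) :
  letter_val (letter_inv l) = (letter_val l)^-1%g.
Proof. by case: l => g []; rewrite /letter_val //= invgK. Qed.

Lemma word_val_cons (G : groupType) (l : G * bool) (w : seq (G * bool)) :
  word_val (l :: w) = (letter_val l * word_val w)%g.
Proof. exact: big_cons. Qed.

Lemma word_val_cat (G : groupType) (v w : seq (G * bool)) :
  word_val (v ++ w) = (word_val v * word_val w)%g.
Proof. exact: big_cat. Qed.

Lemma word_val_inv (G : groupType) (w : seq (G * bool)) :
  word_val (word_inv w) = (word_val w)^-1%g.
Proof.
elim: w => [|l w IH]; first by rewrite /word_val !big_nil invg1.
rewrite /word_inv /= rev_cons -cats1 word_val_cat IH.
rewrite [in RHS]word_val_cons invgM.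
by rewrite /word_val big_seq1 letter_val_inv.
Qed.

(** Says that a removed common prefix was the longest one, which includes the case of an exhausted
    word. *)
Definition diff_heads (T : eqType) (u v : seq T) : bool :=
  match u, v with x :: _, y :: _ => x != y | _, _ => true end.

Lemma common_prefix (T : eqType) (u v : seq T) :
  exists w u' v', [/\ u = w ++ u', v = w ++ v' & diff_heads u' v'].
Proof.
elim: u v => [|x u IH] [|y v]; [by exists [::], [::], [::] |
  by exists [::], [::], (y :: v) | by exists [::], (x :: u), [::] |].
have [<-|xy] := eqVneq x y; last by exists [::], (x :: u), (y :: v).
by have [w [u' [v' [-> -> ?]]]] := IH v; exists (x :: w), u', v'.
Qed.

(** No prefix longer than [w] survives the divergence. In terms of cuts, the product of the
    indicators of two words is that of their longest common prefix. *)
Lemma prefix_common_prefix (T : eqType) (t w u v : seq T) :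
  diff_heads u v -> prefix t (w ++ u) && prefix t (w ++ v) = prefix t w.
Proof.
move=> uv; elim: w t => [|x w IH] [|y t] //=; first by rewrite !prefix0s.
  case: u v uv => [|x u] [|z v] //= xz; first by rewrite andbF.
  by have [->|//] := eqVneq y x; rewrite (negPf xz) andbF.
by rewrite -IH; case: (y == x).
Qed.

(** The only new adjacency is between the inverted head of [u] and the head of [v]; it cancels
    exactly when the heads agree. *)
Lemma reduced_inv_cat (G : groupType) (u v : seq (G * bool)) :
  reduced u -> reduced v -> diff_heads u v -> reduced (word_inv u ++ v).
Proof.
pose e (l l' : G * bool) := ~~ ((l.1 == l'.1) && (l.2 != l'.2)).
have eV l l' : e (letter_inv l') (letter_inv l) = e l l'.
  by case: l l' => [x a] [y b]; rewrite /e /= (eq_sym y); case: a b => [] [].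
move=> ru rv; have {}ru : sorted (fun l l' => e l' l) (map (@letter_inv G) u).
  by rewrite sorted_map; apply: sub_sorted ru => l l' /=; rewrite eV.
case: v rv => [|y v] rv uv; first by rewrite cats0 /reduced rev_sorted.
rewrite /reduced sorted_cat_cons -rev_cons rev_sorted -/e.
apply/andP; split=> //.
case: u ru uv => [|x u] //= ru xy; apply/andP; split=> //.
apply: contra xy; case: x y {ru rv} => [x a] [y b] /= /andP[/eqP -> ab].
by rewrite xpair_eqE eqxx; case: a b ab => [] [].
Qed.

(** Once the tail is reduced, a new letter either stays or cancels the head of the tail; what then
    remains is already reduced, so there is no cascade. *)
Lemma reduce_word (G : groupType) (S : set G) (w : seq (G * bool)) :
  word_in S w ->
  exists v, [/\ word_in S v, reduced v, word_val v = word_val w &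
                (size v <= size w)%N].
Proof.
elim: w => [|l w IH] wS; first by exists [::].
have [l' l'w|v [vS rv vw vs]] := IH; first by apply: wS; rewrite inE l'w orbT.
rewrite word_val_cons -vw.
have lvS : word_in S (l :: v).
  by move=> l'; rewrite inE => /orP[/eqP ->|/vS //]; apply: wS; apply: mem_head.
case: v rv vS {vw} vs lvS => [|k v] rv vS vs lvS.
  by exists [:: l]; rewrite word_val_cons.
have [lk|lk] := boolP ((l.1 == k.1) && (l.2 != k.2)); last first.
  exists (l :: k :: v); split=> //; last by rewrite word_val_cons.
  by rewrite /reduced /= lk.
exists v; split; last by apply: leq_trans (leqW vs); apply: leqW.
- by move=> l' l'v; apply: vS; rewrite inE l'v orbT.
- exact: path_sorted rv.
- have -> : k = letter_inv l.
    by case: l k lk {rv vS vs lvS wS} => [x []] [y []] //= /andP[/eqP -> ].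
  by rewrite word_val_cons letter_val_inv mulVKg.
Qed.

(** Any competing word reduces without growing, and its reduced form is [w] by uniqueness. *)
Lemma word_length_reduced (G : groupType) (S : set G) (w : seq (G * bool)) :
  freely_generates S -> word_in S w -> reduced w ->
  word_length S (word_val w) = size w.
Proof.
move=> free wS rw; apply: word_length_eq => [|k [v [vS <- vw]]].
  by exists w.
have [v' [v'S rv' v'v]] := reduce_word vS.
have [u [_ uniq_u]] := free (word_val w).
by rewrite -(uniq_u w) // (uniq_u v') // v'v.
Qed.

(** The geodesic backs up along [u] to the branching point and then follows [v]: the quotient has
    the reduced word [word_inv u ++ v]. *)
Lemma word_metric_diff_heads (R : realType) (G : groupType) (S : set G)
    (w u v : seq (G * bool)) :
  freely_generates S -> word_in S (w ++ u) -> word_in S (w ++ v) ->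
  reduced (w ++ u) -> reduced (w ++ v) -> diff_heads u v ->
  word_metric R S (word_val (w ++ u)) (word_val (w ++ v)) =
    (size u + size v)%N%:R.
Proof.
move=> free uS vS ru rv uv.
have -> : word_metric R S (word_val (w ++ u)) (word_val (w ++ v)) =
    (word_length S (word_val (word_inv u ++ v)))%:R.
  rewrite /word_metric; congr (word_length S _)%:R.
  by rewrite !word_val_cat word_val_inv invgM -mulgA mulKg.
rewrite word_length_reduced //.
- by rewrite size_cat size_rev size_map.
- move=> l; rewrite mem_cat mem_rev => /orP[/mapP[l' l'u ->]|lv].
    by apply: (uS l'); rewrite mem_cat l'u orbT.
  by apply: vS; rewrite mem_cat lv orbT.
- have [_ ru'] := cat_sorted2 ru; have [_ rv'] := cat_sorted2 rv.
  exact: reduced_inv_cat.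
Qed.

(** * Prefix cuts of a free group *)

(** The members of [r] that are prefixes of [w] are the words [take k w] for 1 <= k <= size w, each
    listed once; excluding the empty word makes the count exact. *)
Lemma sum_prefix (R : pzSemiRingType) (T : eqType) (r : seq (seq T))
    (w : seq T) :
  uniq r -> [::] \notin r ->
  (forall k, (0 < k)%N -> take k w != [::] -> take k w \in r) ->
  \sum_(t <- r) (prefix t w)%:R = (size w)%:R :> R.
Proof.
move=> ur r0 rw; rewrite -natr_sum; congr _%:R.
rewrite -big_mkcond sum1_count -size_filter.
rewrite -[RHS](size_iota 1) -(size_map (fun k => take k w)).
apply/perm_size/uniq_perm.
- exact: filter_uniq.
- rewrite map_inj_in_uniq ?iota_uniq // => k l; rewrite !mem_iota !add1n !ltnS.
  move=> /andP[_ kw] /andP[_ lw] /(congr1 size).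
  by rewrite !size_takel.
move=> t; rewrite mem_filter; apply/andP/mapP => [[tw tr]|[k]].
  exists (size t); last by apply/eqP; rewrite eq_sym -prefixE.
  rewrite mem_iota add1n ltnS size_prefix // andbT lt0n size_eq0.
  by apply: contraNneq r0 => <-.
rewrite mem_iota add1n ltnS => /andP[k0 kw] ->; rewrite prefix_take rw //.
by rewrite -size_eq0 size_takel // -lt0n.
Qed.

(** The distance is |w_i| + |w_j| - 2 |c|, with c the longest common prefix, and each length counts
    prefixes. *)
Lemma freely_generates_sum_sqr (R : realType) (G : groupType) (S : set G)
    (I : finType) (x : I -> G) :
  freely_generates S ->
  exists (T : Type) (r : seq T) (f : T -> I -> R),
    forall i j, word_metric R S (x i) (x j) =
      \sum_(t <- r) (f t i - f t j) ^+ 2.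
Proof.
move=> free.
have /choice[w wE] : forall i, exists w,
    [/\ word_in S w, reduced w & word_val w = x i].
  by move=> i; have [w [? _]] := free (x i); exists w.
(* Only nonempty prefixes of words of the family give cuts that can separate its points; k = 0
   enters through [iota] and is filtered out. *)
pose r := undup [seq t <- flatten
  [seq [seq take k (w i) | k <- iota 0 (size (w i)).+1] | i <- enum I] |
  t != [::]].
exists (seq (G * bool)), r, (fun t i => (prefix t (w i))%:R) => i j.
have ur : uniq r by apply: undup_uniq.
have r0 : [::] \notin r by rewrite mem_undup mem_filter.
have rw h k : (0 < k)%N -> take k (w h) != [::] -> take k (w h) \in r.
  move=> k0 nz; rewrite mem_undup mem_filter /= nz /=.
  apply/flatten_mapP; exists h; first by rewrite mem_enum.
  have -> : take k (w h) = take (minn k (size (w h))) (w h).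
    by have [//|/ltnW ?] := leqP k (size (w h));
      rewrite take_size take_oversize.
  have : minn k (size (w h)) \in iota 0 (size (w h)).+1.
    by rewrite mem_iota add0n ltnS geq_minr.
  exact: (map_f (take^~ (w h))).
have [wiS rwi <-] := wE i; have [wjS rwj <-] := wE j.
have [c [u [v [wi wj uv]]]] := common_prefix (w i) (w j).
have -> : word_metric R S (word_val (w i)) (word_val (w j)) =
    (size u + size v)%N%:R.
  by rewrite wi wj word_metric_diff_heads -?wi -?wj.
(* For indicators, (x - y)^2 = x + y - 2xy. *)
under eq_bigr => t _.
  have -> : ((prefix t (w i))%:R - (prefix t (w j))%:R) ^+ 2 =
     (prefix t (w i))%:R + (prefix t (w j))%:R - (prefix t c)%:R *+ 2 :> R.
    rewrite -(prefix_common_prefix t c uv) -wi -wj.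
    by case: prefix; case: prefix; rewrite /=; ring.
  over.
have rc k : (0 < k)%N -> take k c != [::] -> take k c \in r.
  move=> k0 nz; have [kc|ck] := leqP k (size c).
    by move: (rw i k k0); rewrite wi takel_cat //; apply.
  move: nz; rewrite take_oversize ?(ltnW ck) // => nz.
  move: (rw i (size c)); rewrite wi take_size_cat //; apply => //.
  by rewrite lt0n size_eq0.
rewrite sumrB sumrMnl big_split /= (sum_prefix _ ur r0 (rw i)).
rewrite (sum_prefix _ ur r0 (rw j)) (sum_prefix _ ur r0 rc).
by rewrite wi wj !size_cat !natrD; ring.
Qed.

(** * Stars and the failure above exponent 1 in free groups *)

(* The points [a i] are almost the ends of a star with [m] branches of length
   [N] around [c]: with [N = m ^ 2] the inequality reads
   [(m - 1) (2 m) ^ p <= 2 m (m + 1) ^ p], i.e.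
   [2 ^ (p - 1) <= 1] in the limit. *)
Lemma stars_not_roundness_ineq (R : realType) (X : Type) (d : X -> X -> R)
    (c : X) (p : R) :
  d c c = 0 ->
  (forall m N : nat, exists a : 'I_m -> X,
     (forall i j, i != j -> N.*2%:R <= d (a i) (a j)) /\
     (forall i, 0 <= d (a i) c <= (m + N)%:R)) ->
  1 < p -> ~ roundness_ineq d p.
Proof.
move=> dcc stars p1 dp.
have p0 : 0 < p by rewrite (lt_trans ltr01).
have ln2_gt0 : 0 < ln 2 :> R by rewrite ln_gt0 // ltr1n.
(* Taking logarithms with m = k + 1 gives an estimate whose right side tends to 0 while the left
   side is a fixed positive number. *)
have bound k : (0 < k)%N -> (p - 1) * ln 2 <= (p + 1) / k%:R.
  move=> k0; pose m := k.+1; have [a [far near]] := stars m (m ^ 2)%N.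
  set N := (m ^ 2)%N in far near.
  pose A : R := N.*2%:R `^ p; pose B : R := (m + N)%:R `^ p.
  (* With all b_i at the centre, m (m - 1) / 2 terms of size at least [A] face m^2 terms of size at
     most [B]. *)
  have AB : A *+ k <= B *+ m *+ 2.
    pose f (i j : 'I_m) := if i == j then 0 else A.
    rewrite -(@ler_pMn2r _ m) //.
    have -> : A *+ k *+ m = (\sum_(i < m) \sum_(j < m | (i < j)%N) f i j) *+ 2.
      rewrite -sum_ord_sym /f => [|i|i j]; [|by rewrite eqxx|by rewrite eq_sym].
      rewrite -[m in LHS]card_ord -sumr_const; apply: eq_bigr => i _.
      rewrite (bigD1 i) //= eqxx add0r (eq_bigr (fun=> A)); last first.
        by move=> j /negPf; rewrite eq_sym => ->.
      by rewrite sumr_const cardC1 card_ord.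
    rewrite mulrnAC ler_wMn2r //.
    apply: le_trans (le_trans (dp m a (fun=> c) k0) _).
      apply: ler_sum => i _; apply: ler_sum => j ij.
      have {}ij : i != j by apply: contraTneq ij => ->; rewrite ltnn.
      rewrite /f (negPf ij) dcc powR0 ?gt_eqF // addr0.
      rewrite ge0_ler_powR ?nnegrE ?far ?(ltW p0) //.
      by rewrite (le_trans _ (far i j ij)).
    rewrite -[m in B *+ m *+ _]card_ord -sumr_const.
    rewrite -[X in _ *+ X]card_ord -sumr_const; apply: ler_sum => i _.
    apply: ler_sum => j _; have /andP[dic0 dicN] := near i.
    by rewrite ge0_ler_powR ?nnegrE ?(ltW p0).
  have m0 : 0 < m%:R :> R by rewrite ltr0n.
  have k0R : 0 < k%:R :> R by rewrite ltr0n.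
  (* From ln (1 + x) <= x. It bounds ln (m + 1) - ln m and ln m - ln k by 1/k; the first enters p
     times, the second once, hence p + 1. *)
  have lnS l : (0 < l)%N -> ln l.+1%:R <= ln l%:R + l%:R^-1 :> R.
    move=> l0; have l0R : 0 < l%:R :> R by rewrite ltr0n.
    have -> : l.+1%:R = l%:R * (1 + l%:R^-1) :> R.
      by rewrite mulrDr mulr1 divff ?gt_eqF // -natr1.
    rewrite lnM ?posrE // ?addr_gt0 ?invr_gt0 // lerD2l le_ln1Dx //.
    by rewrite (lt_trans (ltrN10 _)) ?invr_gt0.
  have lnm := lnS k k0; have lnm1 := lnS m isT.
  have mk : m%:R^-1 <= k%:R^-1 :> R by rewrite lef_pV2 ?posrE // ler_nat.
  have lnA : ln (A *+ k) = p * (ln 2 + (ln m%:R + ln m%:R)) + ln k%:R.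
    rewrite -(mulr_natr A) lnM ?posrE ?powR_gt0 ?ltr0n ?double_gt0 ?expn_gt0 //.
    by rewrite /A ln_powR -mul2n natrM natrX expr2 !lnM ?posrE ?mulr_gt0.
  have lnB : ln (B *+ m *+ 2) = p * (ln m%:R + ln m.+1%:R) + ln m%:R + ln 2.
    rewrite -mulrnA -(mulr_natr B) natrM mulrA.
    rewrite !lnM ?posrE ?mulr_gt0 ?powR_gt0 ?ltr0n //.
    rewrite /B ln_powR.
    have -> : (m + N = m * m.+1)%N by rewrite mulnS /N expnS expn1.
    by rewrite natrM lnM ?posrE ?ltr0n.
  have : ln (A *+ k) <= ln (B *+ m *+ 2).
    by rewrite ler_ln ?posrE ?pmulrn_lgt0 ?powR_gt0 ?ltr0n
               ?double_gt0 ?expn_gt0.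
  have : p * ln m.+1%:R <= p * (ln m%:R + k%:R^-1) by rewrite ler_pM2l //; lra.
  rewrite lnA lnB; lra.
(* For k > [y] the estimate [bound] is violated. *)
pose y : R := (p + 1) / ((p - 1) * ln 2).
have y0 : 0 < y by rewrite divr_gt0 ?mulr_gt0 // ?subr_gt0 // addr_gt0.
have /archi_boundP := ltW y0; set k := Num.bound y => yk.
have k0 : (0 < k)%N by rewrite -(ltr_nat R); apply: le_lt_trans yk; apply: ltW.
have := bound k k0; rewrite ler_pdivlMr ?ltr0n //.
by move: yk; rewrite /y ltr_pdivrMr ?mulr_gt0 ?subr_gt0 // mulrC => /lt_geF ->.
Qed.
Lemma reduced_positive (G : groupType) (w : seq (G * bool)) :
  all (fun l => ~~ l.2) w -> reduced w.
Proof.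
case: w => //= x w; elim: w x => //= y w IH x /and3P[/negPf x2 y2 w2].
by rewrite IH ?y2 // x2 (negPf y2) andbF.
Qed.

(** The words s^i t^N and s^j t^N with i < j part after s^i, so they lie at distance 2N + j - i,
    while s^i t^N is at distance i + N from the identity. *)
Lemma free_not_roundness_ineq (R : realType) (G : groupType) (S : set G)
    (s t : G) (p : R) :
  freely_generates S -> S s -> S t -> s != t -> 1 < p ->
  ~ roundness_ineq (word_metric R S) p.
Proof.
move=> free Ss St st.
pose st_word i N := nseq i (s, false) ++ nseq N (t, false).
have stS i N : word_in S (st_word i N).
  by move=> l; rewrite mem_cat !mem_nseq => /orP[]/andP[_ /eqP ->].
have st_red i N : reduced (st_word i N).
  by apply: reduced_positive; rewrite all_cat !all_nseq !orbT.
have distE i j N : (i < j)%N ->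
    word_metric R S (word_val (st_word i N)) (word_val (st_word j N)) =
      (N + (j - i + N))%N%:R /\
    word_metric R S (word_val (st_word j N)) (word_val (st_word i N)) =
      (N + (j - i + N))%N%:R.
  move=> ij.
  have jE : st_word j N = nseq i (s, false) ++ st_word (j - i)%N N.
    by rewrite /st_word catA -nseqD subnKC ?(ltnW ij).
  (* A nonzero j - i makes the second tail start with [s], whereas the first is empty or starts with
     [t]. *)
  have [k kE] : exists k, (j - i)%N = k.+1
    by exists (j - i).-1%N; lia.
  have := st_red i N; have := st_red j N; have := stS i N; have := stS j N.
  have sz : size (st_word (j - i)%N N) = (j - i + N)%N
    by rewrite size_cat !size_nseq.
  rewrite jE => Sj Si rj ri.
  rewrite !word_metric_diff_heads // ?sz ?size_nseq.
  - by split=> //; rewrite addnC.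
  - by rewrite kE; case: (N) => //= M; rewrite xpair_eqE andbT.
  - by rewrite kE; case: (N) => //= M; rewrite xpair_eqE andbT eq_sym.
apply: (@stars_not_roundness_ineq _ _ _ (word_val [::])) => [|m N].
  exact: (@word_metric_diff_heads _ _ _ [::] [::] [::]).
exists (fun i : 'I_m => word_val (st_word i N)); split=> [i j|i].
  rewrite neq_ltn => /orP[] /(distE _ _ N)[h1 h2]; rewrite ?h1 ?h2 ler_nat; lia.
rewrite (@word_metric_diff_heads _ _ _ [::] (st_word i N) [::]) ?cats0 //.
  rewrite ler0n ler_nat /= addn0 size_cat !size_nseq leq_add2r; exact: ltnW.
- exact: stS.
- exact: st_red.
- by case: (st_word _ _).
Qed.

(* A free group of rank n is a group G freely generated by some set of n
   elements; the second claim is made for every such set S. *)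
Theorem corollary3p2 (R : realType) (n : nat) (hn : (2 <= n)%N) :
  gr (word_metric R (canonical_basis n)) = 1%E /\
  (forall (G : groupType) (S : set G),
     (S #= `I_n)%card -> freely_generates S ->
     gr (word_metric R S) = 1%E).
Proof.
split=> [|G S /card_set_bijP[f [_ _ fsurj]] free]; apply: gr_eq1.
- by apply: roundness_ineq_sum_sqr => I x; exact: Zn_sum_sqr.
- by move=> p; apply: Zn_not_roundness_ineq.
- by apply: roundness_ineq_sum_sqr => I x; exact: freely_generates_sum_sqr.
(* The bound n >= 2 supplies two distinct generators, the preimages of 0 and 1. *)
have [s Ss fs] := fsurj 0%N (ltnW hn); have [t St ft] := fsurj 1%N hn.
move=> p; apply: (free_not_roundness_ineq free Ss St).
by apply: contra_eq_neq fs => ->; rewrite ft.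
Qed.
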